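(* Let $K$ be a convex hypersurface in $\mathbb{R}^n$ with interior $I$, let $\Omega=\mathbb{R}^n\setminus\overline{K}$ with its partial order $<$, let $F$ be the timelike Funk distance, and let $\delta$ be the timelike intrinsic distance defined by the functional $f_F$. Then for every pair $(p,q)\in\Omega\times\Omega$ with $p\le q$, \[ F(p,q)=\delta(p,q). \]
   Context: $I\subset\mathbb{R}^n$ is a nonempty open convex set, $I\neq\mathbb{R}^n$ (possibly unbounded), $K=\partial I$, $\overline{K}=K\cup I$, $\Omega=\mathbb{R}^n\setminus\overline{K}$ (if $K$ is a hyperplane, $I$ is a chosen one of the two open half-spaces it bounds). A supporting hyperplane of $K$ is a hyperplane $\pi$ with $\pi\cap K\neq\emptyset$ and such that $I$ is contained in one of the two components of $\mathbb{R}^n\setminus\pi$. $\mathcal{P}(p)$ is the set of supporting hyperplanes $\pi$ of $K$ such that $p$ lies in the open half-space bounded by $\pi$ not containing $I$. $d$ is Euclidean distance. Order: for distinct $p,q\in\Omega$, $p<q$ means: (1) the Euclidean ray $R(p,q)$ from $p$ through $q$ intersects $K$; (2) $R(p,q)$ is not contained in a supporting hyperplane of $K$; (3) the closed segment $[p,q]$ does not intersect $K$. $p\le q$ means $p<q$ or $p=q$. The future of $p$ is $\mathfrak{I}^+(p)=\{q\in\Omega: p<q\}$. Timelike Funk distance: for $p<q$, $F(p,q)=\log\frac{d(p,b(p,q))}{d(q,b(p,q))}$, where $b(p,q)$ is the first intersection point of $R(p,q)$ with $K$; $F(p,p)=0$. Functional: $C^+(p)\subset T_p\Omega=\mathbb{R}^n$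 consists of $0$ and of the nonzero $v$ with $p+tv\in\mathfrak{I}^+(p)$ for some $t>0$. For nonzero $v\in C^+(p)$, $f_F(p,v)=\inf_{\pi\in\mathcal{P}(p)}\frac{\langle v,\eta_\pi\rangle}{d(p,\pi)}$, with $\eta_\pi$ the unit vector at $p$ perpendicular to $\pi$ pointing toward $\pi$; $f_F(p,0)=0$. Intrinsic distance: a piecewise $C^1$ curve $\sigma:[0,1]\to\Omega$ is timelike if $\sigma'(t)\in C^+(\sigma(t))$ for all $t$ (both one-sided derivatives at break points). $\mathrm{Length}(\sigma)=\int_0^1 f_F(\sigma(t),\sigma'(t))\,dt$, and $\delta(p,q)=\sup_\sigma\mathrm{Length}(\sigma)$ over timelike piecewise $C^1$ curves $\sigma:[0,1]\to\Omega$ with $\sigma(0)=p$, $\sigma(1)=q$. *)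

(* Defs.v *)
From HB Require Import structures.
From mathcomp Require Import all_boot all_order all_algebra.
From mathcomp Require Import all_classical all_reals all_analysis.

Set Implicit Arguments.
Unset Strict Implicit.
Unset Printing Implicit Defensive.

Import Order.TTheory GRing.Theory Num.Theory.
Import numFieldNormedType.Exports.

Local Open Scope classical_set_scope.
Local Open Scope ring_scope.

(* The library norm on ['rV[R]_n] is the sup norm.  It is used below only
   through the topology it induces, which is the Euclidean one; every metric
   quantity is written with the explicit Euclidean product, norm and distance. *)

Section Euclidean.
Variables (R : realType) (n : nat).
Implicit Types (p q u v x : 'rV[R]_n) (A hp H : set 'rV[R]_n).

Definition dot u v : R := \sum_(i < n) u ord0 i * v ord0 i.

Definition eucl_norm u : R := Num.sqrt (dot u u).

Definition eucl_dist x y : R := eucl_norm (x - y).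

Definition dist_to_set p A : R := inf [set eucl_dist p x | x in A].

Definition ray p q : set 'rV[R]_n :=
  [set p + t *: (q - p) | t in [set t : R | 0 <= t]].

Definition closed_segment p q : set 'rV[R]_n :=
  [set p + t *: (q - p) | t in [set t : R | 0 <= t <= 1]].

Definition is_hyperplane hp : Prop :=
  exists (a : 'rV[R]_n) (c : R), a != 0 /\ hp = [set x | dot a x = c].

(* [H] is one of the two open half-spaces bounded by [hp], i.e. one of the two
   components of the complement of [hp]; replacing [(a, c)] by [(-a, -c)] gives
   the other one. *)
Definition half_space_of hp H : Prop :=
  exists (a : 'rV[R]_n) (c : R),
    [/\ a != 0, hp = [set x | dot a x = c] & H = [set x | dot a x < c]].

Definition is_unit_normal_toward p hp (e : 'rV[R]_n) : Prop :=
  [/\ eucl_norm e = 1,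
      forall x y, hp x -> hp y -> dot e (x - y) = 0 &
      exists2 t : R, 0 < t & hp (p + t *: e)].

(* When [hp] is a hyperplane and [p] is not on it, there is exactly one such
   vector; otherwise the value is irrelevant. *)
Definition unit_normal_toward p hp : 'rV[R]_n :=
  xget 0 [set e | is_unit_normal_toward p hp e].

End Euclidean.

Section TimelikeFunk.
Variables (R : realType) (n : nat) (I : set 'rV[R]_n).
Implicit Types (p q v b : 'rV[R]_n) (hp H : set 'rV[R]_n).

Definition hypersurface : set 'rV[R]_n := closure I `\` interior I.

Definition exterior : set 'rV[R]_n := ~` (hypersurface `|` I).

Definition supporting_hyperplane hp : Prop :=
  [/\ is_hyperplane hp, hp `&` hypersurface !=set0 &
      exists2 H, half_space_of hp H & I `<=` H].

(* The set [P(p)]. *)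
Definition separating_hyperplanes p : set (set 'rV[R]_n) :=
  [set hp | supporting_hyperplane hp /\
            exists H, [/\ half_space_of hp H, ~ (I `<=` H) & H p]].

Definition precedes p q : Prop :=
  [/\ exterior p, exterior q & p != q] /\
  [/\ ray p q `&` hypersurface !=set0,
      ~ (exists2 hp, supporting_hyperplane hp & ray p q `<=` hp) &
      closed_segment p q `&` hypersurface = set0].

Definition precedes_eq p q : Prop := precedes p q \/ p = q.

Definition future p : set 'rV[R]_n := [set q | precedes p q].

Definition is_first_hit p q b : Prop :=
  exists t : R,
    [/\ 0 <= t, b = p + t *: (q - p), hypersurface b &
        forall s, 0 <= s -> s < t -> ~ hypersurface (p + s *: (q - p))].

(* Unique when it exists, which is the case for [precedes p q]. *)
Definition first_hit p q : 'rV[R]_n := xget 0 [set b | is_first_hit p q b].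

Definition funk_dist p q : R :=
  if p == q then 0
  else ln (eucl_dist p (first_hit p q) / eucl_dist q (first_hit p q)).

Definition timelike_cone p : set 'rV[R]_n :=
  [set v | v = 0 \/
           (v != 0 /\ exists2 t : R, 0 < t & future p (p + t *: v))].

Definition funk_functional p v : R :=
  if v == 0 then 0
  else inf [set dot v (unit_normal_toward p hp) / dist_to_set p hp
           | hp in separating_hyperplanes p].

End TimelikeFunk.

(* A curve on [0, 1] is represented by a function on [R] of which only the
   restriction to [0, 1] matters. *)

Section Curves.
Variables (R : realType) (n : nat).
Implicit Types (sigma : R -> 'rV[R]_n) (v : 'rV[R]_n) (t : R).

Definition is_right_derivative sigma t v : Prop :=
  h^-1 *: (sigma (t + h) - sigma t) @[h --> 0^'+] --> v.

Definition is_left_derivative sigma t v : Prop :=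
  h^-1 *: (sigma (t + h) - sigma t) @[h --> 0^'-] --> v.

Definition C1_on_segment (a b : R) sigma : Prop :=
  exists dsigma : R -> 'rV[R]_n,
    [/\ {within `[a, b], continuous dsigma},
        forall t, a <= t < b -> is_right_derivative sigma t (dsigma t) &
        forall t, a < t <= b -> is_left_derivative sigma t (dsigma t)].

(* The one-sided derivatives at the break points make [sigma] continuous on
   [0, 1]. *)
Definition piecewise_C1 sigma : Prop :=
  exists s : seq R, itv_partition 0 1 s /\
    forall i, (i < size s)%N ->
      C1_on_segment (nth 0 (0 :: s) i) (nth 0 s i) sigma.

Definition timelike_curve (I : set 'rV[R]_n) (p q : 'rV[R]_n) sigma : Prop :=
  [/\ piecewise_C1 sigma,
      forall t, 0 <= t <= 1 -> exterior I (sigma t),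
      forall t v, 0 <= t < 1 -> is_right_derivative sigma t v ->
        timelike_cone I (sigma t) v,
      forall t v, 0 < t <= 1 -> is_left_derivative sigma t v ->
        timelike_cone I (sigma t) v &
      sigma 0 = p /\ sigma 1 = q].

(* [derive1 sigma] is the actual derivative away from the finitely many break
   points and end points, which are negligible for the Lebesgue measure. *)
Definition curve_length (I : set 'rV[R]_n) sigma : \bar R :=
  (\int[lebesgue_measure]_(t in `[0%R, 1%R])
     (funk_functional I (sigma t) (derive1 sigma t))%:E)%E.

Definition intrinsic_dist (I : set 'rV[R]_n) (p q : 'rV[R]_n) : \bar R :=
  ereal_sup [set curve_length I sigma | sigma in timelike_curve I p q].

End Curves.

(* Main.v *)
Require Import Defs.
From mathcomp Require Import all_boot all_order all_algebra.
From mathcomp Require Import all_classical all_reals all_analysis.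
From mathcomp Require Import measurable_realfun.
From mathcomp Require Import ring lra.

(* Every supporting hyperplane {x | a.x = c} of K that separates p from I, with
   I on the side a.x < c, contributes the term - a.v / (a.p - c) to f_F(p, v):
   minus the logarithmic derivative of a.x - c along v.

   Upper bound: fix such a hyperplane at the first hit point b of the ray from
   p through q.  Along a timelike curve from p to q the function
   g = a.sigma - c is positive and nonincreasing, and f_F <= - g'/g, so the
   length is at most ln (g(p) / g(q)), which is F(p, q) because p, q and b are
   collinear.

   Lower bound: on the segment from p to q, the ray reaches I beyond b, so it
   crosses every separating hyperplane before b; the infimum defining f_F is
   therefore attained at b, f_F(p + t (q - p), q - p) = 1 / (T - t) with
   b = p + T (q - p), and the length of the segment is F(p, q).

   The existence of the hyperplane at b, and the fact that the ray really
   enters I, come from the separation of a point from an open convex set. *)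

Set Implicit Arguments.
Unset Strict Implicit.
Unset Printing Implicit Defensive.

Import Order.TTheory GRing.Theory Num.Theory.
Import numFieldNormedType.Exports.
Local Open Scope classical_set_scope.
Local Open Scope ring_scope.

(** * Euclidean product *)

Lemma dotC (R : realType) n (u v : 'rV[R]_n) : dot u v = dot v u.
Proof. by rewrite /dot; apply: eq_bigr => i _; rewrite mulrC. Qed.

Lemma dotDr (R : realType) n (u v w : 'rV[R]_n) :
  dot u (v + w) = dot u v + dot u w.
Proof.
by rewrite /dot -big_split; apply: eq_bigr => i _; rewrite mxE mulrDr.
Qed.

Lemma dotZr (R : realType) n (u v : 'rV[R]_n) k : dot u (k *: v) = k * dot u v.
Proof.
by rewrite /dot mulr_sumr; apply: eq_bigr => i _; rewrite mxE mulrCA.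
Qed.

Lemma dotNr (R : realType) n (u v : 'rV[R]_n) : dot u (- v) = - dot u v.
Proof. by rewrite -scaleN1r dotZr mulN1r. Qed.

Lemma dotBr (R : realType) n (u v w : 'rV[R]_n) :
  dot u (v - w) = dot u v - dot u w.
Proof. by rewrite dotDr dotNr. Qed.

Lemma dotDl (R : realType) n (u v w : 'rV[R]_n) :
  dot (v + w) u = dot v u + dot w u.
Proof. by rewrite dotC dotDr !(dotC u). Qed.

Lemma dotZl (R : realType) n (u v : 'rV[R]_n) k : dot (k *: v) u = k * dot v u.
Proof. by rewrite dotC dotZr dotC. Qed.

Lemma dotNl (R : realType) n (u v : 'rV[R]_n) : dot (- v) u = - dot v u.
Proof. by rewrite dotC dotNr dotC. Qed.

Lemma dotBl (R : realType) n (u v w : 'rV[R]_n) :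
  dot (v - w) u = dot v u - dot w u.
Proof. by rewrite dotDl dotNl. Qed.

Lemma dot0r (R : realType) n (u : 'rV[R]_n) : dot u 0 = 0.
Proof. by rewrite -(scale0r 0) dotZr mul0r. Qed.

Lemma dot0l (R : realType) n (u : 'rV[R]_n) : dot 0 u = 0.
Proof. by rewrite dotC dot0r. Qed.

Lemma dot_ge0 (R : realType) n (u : 'rV[R]_n) : 0 <= dot u u.
Proof. by apply: sumr_ge0 => i _; rewrite -expr2 sqr_ge0. Qed.

Lemma sqr_coord_le_dot (R : realType) n (u : 'rV[R]_n) i :
  u ord0 i ^+ 2 <= dot u u.
Proof.
rewrite /dot (bigD1 i)//= -expr2 lerDl.
by apply: sumr_ge0 => j _; rewrite -expr2 sqr_ge0.
Qed.

Lemma dot_eq0 (R : realType) n (u : 'rV[R]_n) : (dot u u == 0) = (u == 0).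
Proof.
apply/eqP/eqP => [u0|->]; last exact: dot0r.
apply/rowP => i; rewrite mxE; apply/eqP.
by rewrite -sqrf_eq0 eq_le sqr_ge0 andbT -u0 sqr_coord_le_dot.
Qed.

Lemma dot_gt0 (R : realType) n (u : 'rV[R]_n) : (0 < dot u u) = (u != 0).
Proof. by rewrite lt_neqAle dot_ge0 andbT eq_sym dot_eq0. Qed.

Lemma sqr_normDZ (R : realType) n (u v : 'rV[R]_n) (k : R) :
  dot (u + k *: v) (u + k *: v) = dot u u + k * (2 * dot u v + k * dot v v).
Proof. by rewrite !(dotDl, dotDr, dotZl, dotZr) (dotC v u); ring. Qed.

Lemma eucl_norm_ge0 (R : realType) n (u : 'rV[R]_n) : 0 <= eucl_norm u.
Proof. exact: sqrtr_ge0. Qed.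

Lemma eucl_norm_gt0 (R : realType) n (u : 'rV[R]_n) :
  (0 < eucl_norm u) = (u != 0).
Proof. by rewrite sqrtr_gt0 dot_gt0. Qed.

Lemma sqr_eucl_norm (R : realType) n (u : 'rV[R]_n) :
  eucl_norm u ^+ 2 = dot u u.
Proof. by rewrite sqr_sqrtr// dot_ge0. Qed.

Lemma eucl_normZ (R : realType) n (u : 'rV[R]_n) k :
  eucl_norm (k *: u) = `|k| * eucl_norm u.
Proof.
by rewrite /eucl_norm dotZl dotZr mulrA -expr2 sqrtrM ?sqr_ge0// sqrtr_sqr.
Qed.

(** The square of the inequality is read off the nonnegative squared norm of (u.u) v - (u.v) u,
    which equals (u.u) ((u.u) (v.v) - (u.v)^2). *)
Lemma Cauchy_Schwarz (R : realType) n (u v : 'rV[R]_n) :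
  `|dot u v| <= eucl_norm u * eucl_norm v.
Proof.
have [->|u0] := eqVneq u 0.
  by rewrite dot0l normr0 mulr_ge0// eucl_norm_ge0.
rewrite -(@ler_pXn2r _ 2)// ?nnegrE ?mulr_ge0 ?eucl_norm_ge0//.
rewrite -normrX ger0_norm ?sqr_ge0// exprMn !sqr_eucl_norm.
have := dot_ge0 (dot u u *: v - dot u v *: u).
rewrite !(dotBr, dotBl, dotZl, dotZr) (dotC v u).
rewrite (_ : _ - _ = dot u u * (dot u u * dot v v - dot u v ^+ 2));
  last by ring.
by rewrite pmulr_rge0 ?dot_gt0// subr_ge0.
Qed.

(** * Continuity of the Euclidean product and compactness of balls *)

Lemma dot_continuous (R : realType) n (u : 'rV[R]_n) : continuous (dot u).
Proof.
move=> v; rewrite /dot.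
apply: cvg_big => [x||i _];
  [exact: add_continuous|exact: nbhs_filter|apply: cvgM].
- exact: nbhs_filter.
- by apply: cvg_cst; exact: nbhs_filter.
- exact: coord_continuous.
Qed.

Lemma sqr_norm_continuous (R : realType) n :
  continuous (fun u : 'rV[R]_n => dot u u).
Proof.
move=> v; rewrite /dot.
apply: cvg_big => [x||i _];
  [exact: add_continuous|exact: nbhs_filter|apply: cvgM].
- exact: nbhs_filter.
- exact: coord_continuous.
- exact: coord_continuous.
Qed.

Lemma sqr_dist_continuous (R : realType) n (b : 'rV[R]_n) :
  continuous (fun x : 'rV[R]_n => dot (x - b) (x - b)).
Proof.
move=> x.
have xb : y - b @[y --> x] --> x - b.
  exact: (cvgB (@cvg_id _ (nbhs x)) (cvg_cst b)).
exact: cvg_comp xb (@sqr_norm_continuous R n (x - b)).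
Qed.

(** Boundedness is meant for the sup norm: each coordinate of x - b has absolute value at most sqrt
    r. *)
Lemma sqr_norm_ball_compact (R : realType) n (b : 'rV[R]_n) (r : R) :
  compact [set x | dot (x - b) (x - b) <= r].
Proof.
apply: bounded_closed_compact; last first.
  apply: (@preimage_closed _ _ (fun x : 'rV[R]_n => dot (x - b) (x - b))
    [set y | y <= r]); last exact: closed_le.
  by move=> x _; exact: sqr_dist_continuous.
exists (`|b| + Num.sqrt r); split; first exact: num_real.
move=> M Mr x /= xb.
rewrite (le_trans _ (ltW Mr))//.
rewrite -(subrK b x) addrC (le_trans (ler_normD _ _))// lerD2l.
have r0 : 0 <= r by rewrite (le_trans _ xb)// dot_ge0.
rewrite /Num.Def.normr/= mx_normrE; apply: bigmax_le => [|[i j] _].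
  by rewrite sqrtr_ge0.
rewrite (ord1 i)/= -sqrtr_sqr ler_sqrt//.
exact: le_trans (sqr_coord_le_dot _ _) xb.
Qed.

(** * Separation of a point from an open convex set *)

Lemma convex_setP (R : realType) n (A : set 'rV[R]_n) : convex_set A ->
  forall x y s, A x -> A y -> 0 <= s -> s <= 1 -> A (s *: x + (1 - s) *: y).
Proof.
move=> cA x y s Ax Ay s0 s1.
by have := cA x y (Itv01 s0 s1) (mem_set Ax) (mem_set Ay); rewrite inE.
Qed.

(** The continuous map [f] sends y to x, hence sends some point y' of A close to y into the open set
    A; the combination z then lies between the points [f y'] and y' of A. *)
Lemma convex_open_closure (R : realType) n (A : set 'rV[R]_n) :
  convex_set A -> open A -> forall x y s, A x -> closure A y ->
  0 < s -> s <= 1 -> A (s *: x + (1 - s) *: y).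
Proof.
move=> cA oA x y s Ax cAy s0 s1; set z := s *: x + (1 - s) *: y.
pose f (y' : 'rV[R]_n) := s^-1 *: (z - (1 - s) *: y').
have fy : f y = x by rewrite /f /z addrK scalerA mulVf ?scale1r// gt_eqF.
have cf : f y' @[y' --> y] --> f y.
  exact: (cvgZl_tmp (cvgB (cvg_cst z) (cvgZl_tmp (@cvg_id _ (nbhs y))))).
have /cAy[y' [Ay' Afy']] : nbhs y (f @^-1` A).
  by apply: cf; rewrite fy; apply: open_nbhs_nbhs.
have -> : z = s *: f y' + (1 - s) *: y'.
  by rewrite /f scalerA divff ?gt_eqF// scale1r subrK.
exact: convex_setP (ltW s0) s1.
Qed.

(** It suffices to minimise over the part of D in the closed ball around b through some point of D,
    which is compact. *)
Lemma nearest_point (R : realType) n (D : set 'rV[R]_n) (b : 'rV[R]_n) :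
  closed D -> D !=set0 ->
  exists2 x0, D x0 &
    forall x, D x -> dot (x0 - b) (x0 - b) <= dot (x - b) (x - b).
Proof.
move=> cD [x1 Dx1]; set r := dot (x1 - b) (x1 - b).
have cK := compact_closedI (sqr_norm_ball_compact (b:=b) (r:=r)) cD.
have K0 : ([set x | dot (x - b) (x - b) <= r] `&` D) !=set0.
  by exists x1; split => //=.
have [x0 x0K x0min] :=
  EVT_min_rV K0 cK (continuous_subspaceT (@sqr_dist_continuous R n b)).
move: x0K; rewrite inE => -[/= x0r Dx0]; exists x0 => // x Dx.
have [xr|/ltW rx] := leP (dot (x - b) (x - b)) r; last exact: le_trans rx.
by apply: x0min; rewrite inE.
Qed.

(** The normal points from the nearest point x0 of the closure to b; minimality along segments from
    x0 into C gives the inequality. It is normalised so that a compactness argument can be run on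
    such normals. *)
Lemma separation_closure (R : realType) n (C : set 'rV[R]_n) (b : 'rV[R]_n) :
  open C -> convex_set C -> C !=set0 -> ~ closure C b ->
  exists2 a, dot a a = 1 & forall x, C x -> dot a x <= dot a b.
Proof.
move=> oC cC C0 Cb.
have [|x0 Cx0 x0min] := @nearest_point R n (closure C) b (@closed_closure _ C).
  by case: C0 => x Cx; exists x; exact: subset_closure.
have bx0 : b - x0 != 0.
  by apply/eqP => /subr0_eq bx0; apply: Cb; rewrite bx0.
pose k := eucl_norm (b - x0); have k0 : 0 < k by rewrite eucl_norm_gt0.
exists (k^-1 *: (b - x0)).
  rewrite dotZl dotZr -sqr_eucl_norm -/k.
  by field; rewrite gt_eqF.
move=> x Cx; rewrite !dotZl ler_pM2l ?invr_gt0//.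
set u := x - x0; set w := x0 - b.
have key s : 0 < s -> s <= 1 -> 0 <= 2 * dot w u + s * dot u u.
  move=> s0 s1.
  have := x0min _ (subset_closure (convex_open_closure cC oC Cx Cx0 s0 s1)).
  have -> : s *: x + (1 - s) *: x0 - b = w + s *: u.
    by apply/rowP => i; rewrite !mxE; ring.
  by rewrite sqr_normDZ lerDl pmulr_rge0.
have wu : 0 <= dot w u.
  rewrite leNgt; apply/negP => wu.
  have u0 := dot_ge0 u.
  (* If w.u < 0, this s satisfies s (u.u + 1) <= - w.u, hence 2 w.u + s u.u < 0; the summand 1 keeps
     the denominator positive. *)
  pose s := Num.min 1 (- dot w u / (dot u u + 1)).
  have s0 : 0 < s by rewrite lt_min ltr01/= divr_gt0 ?oppr_gt0 ?ltr_pwDr.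
  have s1 : s <= 1 by rewrite ge_min lexx.
  have := key s s0 s1; rewrite leNgt => /negP; apply.
  have : s * (dot u u + 1) <= - dot w u.
    by rewrite -ler_pdivlMr ?ltr_pwDr// ge_min lexx orbT.
  nra.
have := dot_ge0 w.
move: wu; rewrite /u /w !(dotBl, dotBr) (dotC x0 x) (dotC b x) (dotC x0 b).
lra.
Qed.

Lemma line_cvg (R : realType) n (x v : 'rV[R]_n) (t : R) :
  x + s *: v @[s --> t] --> x + t *: v.
Proof. exact: (cvgD (cvg_cst x) (cvgZr_tmp (@cvg_id _ (nbhs t)))). Qed.

Lemma open_line (R : realType) n (A : set 'rV[R]_n) (x v : 'rV[R]_n) (t : R) :
  open A -> A (x + t *: v) ->
  exists2 e : R, 0 < e & forall s, `|s - t| < e -> A (x + s *: v).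
Proof.
move=> oA Axt.
have : \forall s \near t, A (x + s *: v).
  by apply: (@line_cvg R n x v t); exact: open_nbhs_nbhs.
move=> /nbhs_ballP[e /= e0 He]; exists e => // s st.
by apply: He; rewrite /ball/= distrC.
Qed.

(** Unit normals separating C from points outside its closure that tend to b have a cluster point on
    the unit sphere. It separates weakly, and openness of C makes the inequality strict. *)
Lemma open_convex_separation (R : realType) n (C : set 'rV[R]_n) b :
  open C -> convex_set C -> C !=set0 -> ~ C b ->
  exists a, forall x, C x -> dot a x < dot a b.
Proof.
move=> oC cC C0 nCb; have [x0 Cx0] := C0.
(* b may lie in the closure of C, but the points bk do not, since b is strictly
   between bk k and a point of C. *)
pose bk (k : nat) := b + k.+1%:R^-1 *: (b - x0).
have bkC k : ~ closure C (bk k).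
  move=> Cbk; apply: nCb.
  have h0 : 0 < (1 + k.+1%:R)^-1 :> R by rewrite invr_gt0 ltr_pwDl.
  have h1 : (1 + k.+1%:R)^-1 <= 1 :> R by rewrite invf_le1 ?lerDl// ltr_pwDl.
  have := convex_open_closure cC oC Cx0 Cbk h0 h1.
  congr C; apply/rowP => i; rewrite !mxE.
  have k0 : (k.+1%:R : R) != 0 by [].
  have k1 : (1 + k.+1%:R : R) != 0 by rewrite gt_eqF// ltr_pwDl.
  by field; rewrite nat1r k0 k1.
have {}bkC k : {a | dot a a = 1 & forall x, C x -> dot a x <= dot a (bk k)}.
  by apply/cid2; exact: separation_closure.
pose ak k := s2val (bkC k).
have ak1 k : dot (ak k) (ak k) = 1 by exact: (s2valP (bkC k)).
have akC k x : C x -> dot (ak k) x <= dot (ak k) (bk k).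
  exact: (s2valP' (bkC k)).
have cK : compact ([set u : 'rV[R]_n | dot (u - 0) (u - 0) <= 1] `&`
                   [set u | 1 <= dot u u]).
  apply: compact_closedI; first exact: sqr_norm_ball_compact.
  apply: (@preimage_closed _ _ (fun u : 'rV[R]_n => dot u u) [set y | 1 <= y]).
    by move=> u _; exact: sqr_norm_continuous.
  exact: closed_ge.
have [|a [[_ a1] acl]] := cK (ak @ \oo) _.
  by exists 0%N => // k _ /=; rewrite subr0 ak1.
have aC x : C x -> dot a x <= dot a b.
  move=> Cx; rewrite leNgt; apply/negP => bx.
  (* Half of the supposed excess a.(x - b). Some [ak k] close to a, with k large, has product with x
     - b above d, whereas separation from [bk k] bounds this product by M / (k + 1) < d. *)
  pose d := dot (x - b) a / 2.
  have d0 : 0 < d by rewrite divr_gt0// dotC dotBr subr_gt0.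
  pose M := eucl_norm (b - x0).
  have FA : (ak @ \oo) [set ak k | k in [set k | k.+1%:R^-1 * M < d]].
    have : \forall k \near \oo, k.+1%:R^-1 * M < d.
      have M0 : 0 < M + 1 by rewrite ltr_wpDl ?eucl_norm_ge0.
      have := near_infty_natSinv_lt (PosNum (divr_gt0 d0 M0)).
      apply: filterS => k /=; rewrite ltr_pdivlMr// mulrDr mulr1.
      by apply: le_lt_trans; rewrite lerDl invr_ge0.
    by apply: filterS => k kM /=; exists k.
  have [] := acl _ [set u | d < dot (x - b) u] FA _.
    have /(@dot_continuous R n (x - b) a)// :
      nbhs (dot (x - b) a) [set y | d < y].
    apply: open_nbhs_nbhs; split; first exact: open_gt.
    by move: d0; rewrite /= /d; lra.
  move=> _ [[k /= kM <-]] /=; apply/negP; rewrite -leNgt.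
  rewrite dotC dotBr lerBlDr (le_trans (akC k _ Cx))//.
  rewrite /bk dotDr dotZr addrC lerD2r (le_trans _ (ltW kM))//.
  rewrite ler_pM2l ?invr_gt0// (le_trans (ler_norm _))//.
  rewrite (le_trans (Cauchy_Schwarz _ _))//.
  by rewrite /eucl_norm ak1 sqrtr1 mul1r.
exists a => x Cx.
(* A short step from x along a stays in C and strictly increases the product with a. *)
have [|e e0 xe] := @open_line R n C x a 0 oC; first by rewrite scale0r addr0.
have /xe/aC : `|e / 2 - 0| < e by rewrite subr0 gtr0_norm; lra.
rewrite dotDr dotZr; apply: lt_le_trans.
by rewrite ltrDl mulr_gt0 ?divr_gt0// (lt_le_trans ltr01).
Qed.

(** * Supporting hyperplanes *)

(** A normal is parallel to a, and its sign is forced: going from p toward the hyperplane must lower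
    the product with a to c. *)
Lemma unit_normal_towardE (R : realType) n (a p : 'rV[R]_n) c :
  a != 0 -> c < dot a p ->
  unit_normal_toward p [set x | dot a x = c] = - (eucl_norm a)^-1 *: a.
Proof.
move=> a0 cp; have na : 0 < eucl_norm a by rewrite eucl_norm_gt0.
have aa : dot a a = eucl_norm a ^+ 2 by rewrite sqr_eucl_norm.
have na0 : eucl_norm a != 0 by rewrite gt_eqF.
apply: xget_unique => [|e [e1 eh [t t0 /= pte]]].
  split => [|x y /= ax ay|].
  - by rewrite eucl_normZ normrN gtr0_norm ?invr_gt0// mulVf.
  - by rewrite dotZl dotBr ax ay subrr mulr0.
  - exists ((dot a p - c) / eucl_norm a); first by rewrite divr_gt0// subr_gt0.
    by rewrite /= dotDr !dotZr aa; field.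
pose k := dot a e / dot a a.
(* The part w of e orthogonal to a is a direction of the hyperplane, so e.w = 0 and therefore w.w =
   0. *)
have eka : e = k *: a.
  apply/eqP; rewrite -subr_eq0 -dot_eq0; set w := e - k *: a.
  have aw : dot a w = 0 by rewrite /w dotBr dotZr /k aa; field.
  have ew : dot e w = 0.
    have := eh (p + t *: e + w) (p + t *: e).
    by rewrite [_ + w]addrC addrK; apply => //=; rewrite dotDr pte aw add0r.
  by rewrite {1}/w dotBl dotZl aw ew mulr0 subr0.
have k0 : k < 0.
  rewrite ltNge; apply/negP => k0; move: pte.
  apply/eqP; rewrite gt_eqF// (lt_le_trans cp)// dotDr lerDl eka !dotZr.
  by rewrite mulr_ge0 ?(ltW t0)// mulr_ge0// dot_ge0.
rewrite eka; congr (_ *: _); rewrite -[k](mulfK na0).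
move: e1; rewrite eka eucl_normZ ltr0_norm// mulNr => /eqP.
by rewrite eqr_oppLR => /eqP ->; rewrite mulN1r.
Qed.

(** Cauchy-Schwarz gives the lower bound, and the foot of the perpendicular from p attains it. *)
Lemma dist_to_hyperplane (R : realType) n (a p : 'rV[R]_n) c :
  a != 0 -> c < dot a p ->
  dist_to_set p [set x | dot a x = c] = (dot a p - c) / eucl_norm a.
Proof.
move=> a0 cp; have na : 0 < eucl_norm a by rewrite eucl_norm_gt0.
have na0 : eucl_norm a != 0 by rewrite gt_eqF.
set d := _ / _; set A := [set x | _].
have lbA : lbound [set eucl_dist p x | x in A] d.
  move=> _ [x /= ax <-]; rewrite ler_pdivrMr// -ax -dotBr mulrC.
  by rewrite (le_trans (ler_norm _))// Cauchy_Schwarz.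
have Ad : [set eucl_dist p x | x in A] d.
  exists (p - (d / eucl_norm a) *: a).
    by rewrite /A/= dotBr dotZr -sqr_eucl_norm /d; field.
  rewrite /eucl_dist opprB addrCA subrr addr0 eucl_normZ ger0_norm ?divfK//.
  by rewrite /d !divr_ge0 ?ltW ?subr_gt0.
apply/eqP; rewrite eq_le; apply/andP; split.
  by apply: ge_inf => //; exists d.
by apply: lb_le_inf => //; exists d.
Qed.

(** The norm of a cancels between the normal and the distance. *)
Lemma funk_termE (R : realType) n (a p v : 'rV[R]_n) c :
  a != 0 -> c < dot a p ->
  dot v (unit_normal_toward p [set x | dot a x = c]) /
    dist_to_set p [set x | dot a x = c] = - dot a v / (dot a p - c).
Proof.
move=> a0 cp; rewrite unit_normal_towardE// dist_to_hyperplane// dotZr dotC.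
have na0 : eucl_norm a != 0 by rewrite gt_eqF// eucl_norm_gt0.
by field; rewrite na0 subr_eq0 gt_eqF.
Qed.

(** The definition describes the two half-spaces by possibly different equations of [hp]; here a
    single equation has I below it and p above it. *)
Lemma separating_hyperplanesP (R : realType) n (I : set 'rV[R]_n) p hp :
  separating_hyperplanes I p hp <->
  exists a c, [/\ a != 0, hp = [set x | dot a x = c],
    hp `&` hypersurface I !=set0, I `<=` [set x | dot a x < c] & c < dot a p].
Proof.
split=> [[[_ hK [H [a [c [a0 hpE ->]] IH]]]]|[a [c [a0 hpE hK Ic cp]]]].
  move=> [_ [[a' [c' [a'0 hpE' ->]] IH' /= pc']]].
  exists a, c; split => //; rewrite ltNge; apply/negP => pc.
  have {}pc : dot a p < c.
    rewrite lt_neqAle pc andbT; apply/eqP => apc.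
    have : hp p by rewrite hpE.
    by rewrite hpE' /= => a'pc; move: pc'; rewrite a'pc ltxx.
  apply: IH' => x Ix /=; rewrite ltNge; apply/negP => xc'.
  (* Parameter at which the segment from p to x crosses [hp]. With x and p both strictly below c for
     a, no such crossing can exist. *)
  pose s := (c' - dot a' p) / (dot a' x - dot a' p).
  have s0 : 0 <= s by rewrite divr_ge0//; lra.
  have s1 : s <= 1 by rewrite ler_pdivrMr; lra.
  have xp : dot a' x - dot a' p != 0.
    by rewrite gt_eqF// subr_gt0 (lt_le_trans pc').
  have : hp (s *: x + (1 - s) *: p).
    by rewrite hpE' /= dotDr !dotZr /s; field.
  have /= xc := IH _ Ix.
  rewrite hpE /= dotDr !dotZr; move: s s0 s1 => s s0 s1.
  by have [s2|s2] := leP s (1 / 2); nra.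
split; last first.
  exists [set x | dot (- a) x < - c]; split.
  - exists (- a), (- c); split; rewrite ?oppr_eq0// hpE.
    by apply/seteqP; split=> x /=; rewrite dotNl; [move=> ->|move/oppr_inj].
  - have [x [hpx Kx]] := hK.
    have [y [Iy _]] := Kx.1 _ filterT.
    move=> /(_ y Iy) /=; rewrite dotNl ltrN2 ltNge; apply/negP.
    by rewrite negbK ltW// Ic.
  - by rewrite /= dotNl ltrN2.
split=> //; first by exists a, c.
by exists [set x | dot a x < c] => //; exists a, c.
Qed.

Lemma closure_le_half_space (R : realType) n (I : set 'rV[R]_n) a c :
  I `<=` [set x | dot a x < c] -> closure I `<=` [set x | dot a x <= c].
Proof.
move=> Ic x Ix; have cH : closed [set x : 'rV[R]_n | dot a x <= c].
  apply: (@preimage_closed _ _ (dot a) [set y | y <= c]); last exact: closed_le.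
  by move=> y _; exact: dot_continuous.
rewrite (closure_id [set x | dot a x <= c]).1//.
by apply: closureS Ix => y /Ic /ltW.
Qed.

Lemma exteriorE (R : realType) n (I : set 'rV[R]_n) :
  open I -> exterior I = ~` closure I.
Proof.
move=> oI; rewrite /exterior /hypersurface; congr (~` _).
rewrite (interior_id I).1// setDKU//; exact: subset_closure.
Qed.

(** T is the least nonnegative parameter at which the ray meets the closure of I. That point is not
    in I, since I is open, so a hyperplane separates it from I; as the ray is in I later, at t1, the
    product with a decreases along v. *)
Lemma entry_point (R : realType) n (I : set 'rV[R]_n) p v t1 :
  open I -> convex_set I -> ~ closure I p -> 0 < t1 -> I (p + t1 *: v) ->
  exists T, [/\ 0 < T, T < t1, hypersurface I (p + T *: v),
    forall s, 0 <= s -> s < T -> ~ closure I (p + s *: v) &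
    exists2 a, I `<=` [set x | dot a x < dot a (p + T *: v)] & dot a v < 0].
Proof.
move=> oI cI pI t10 It1.
pose E := [set s | 0 <= s /\ closure I (p + s *: v)].
have Et1 : E t1 by split; [exact: ltW|exact: subset_closure].
have lbE : lbound E 0 by move=> s [].
have hE : has_inf E by split; [exists t1|exists 0].
pose T := inf E.
have T0 : 0 <= T by apply: lb_le_inf => //; exists t1.
have TE s : E s -> T <= s by move=> Es; apply: ge_inf => //; exists 0.
have IT : closure I (p + T *: v).
  apply: contrapT => nIT.
  have [|e e0 He] := @open_line R n (~` closure I) p v T _ nIT.
    exact/closed_openC/closed_closure.
  have [s Es sT] := inf_adherent e0 hE.
  apply: (He s); last by case: Es.
  by rewrite ger0_norm ?subr_ge0 ?TE// ltrBlDl.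
have {}T0 : 0 < T.
  rewrite lt_neqAle T0 andbT; apply/eqP => T00.
  by move: IT; rewrite -T00 scale0r addr0.
have nIT : ~ I (p + T *: v).
  move=> /(open_line oI)[e e0 He].
  (* A neighbourhood of T in I would contain either the parameter 0, that is p, or the earlier
     parameter T - e / 2. *)
  have [Te|eT] := leP T (e / 2).
    apply: pI; rewrite -[p]addr0 -[0](scale0r v); apply: subset_closure.
    by apply: He; rewrite sub0r normrN gtr0_norm//; lra.
  have /TE : E (T - e / 2).
    split; first lra.
    apply: subset_closure; apply: He.
    by rewrite addrAC subrr add0r normrN gtr0_norm; lra.
  by rewrite leNgt => /negP; apply; lra.
have Tt1 : T < t1.
  by rewrite lt_neqAle TE// andbT; apply/eqP => TT; apply: nIT; rewrite TT.
exists T; split => //.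
- by split=> // /interior_subset.
- by move=> s s0 sT Is; move: sT; rewrite ltNge TE.
- have [|a Ia] := open_convex_separation oI cI _ nIT.
    by exists (p + t1 *: v).
  exists a => //; have := Ia _ It1; rewrite !dotDr !dotZr; nra.
Qed.

(** * The causal order *)

Lemma closed_segment_param (R : realType) n (p v : 'rV[R]_n) k s :
  p + s *: (p + k *: v - p) = p + (s * k) *: v.
Proof. by rewrite [p + _ - p]addrAC subrr add0r scalerA. Qed.

(** The point halfway to the entry point is in the future of p: the segment to it stops before K,
    and the ray contains a point of I, which no supporting hyperplane does. *)
Lemma timelike_cone_entry (R : realType) n (I : set 'rV[R]_n) p v t1 :
  open I -> convex_set I -> ~ closure I p -> 0 < t1 -> I (p + t1 *: v) ->
  timelike_cone I p v.
Proof.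
move=> oI cI pI t10 It1.
have [T [T0 Tt1 KT before _]] := entry_point oI cI pI t10 It1.
have v0 : v != 0.
  apply/eqP => v0; apply: pI; apply: subset_closure.
  by move: It1; rewrite v0 scaler0 addr0.
right; split => //; exists (T / 2); first by rewrite divr_gt0.
split.
  rewrite !exteriorE//; split => //=; first by apply: before; lra.
  rewrite -subr_eq0 opprD addrA subrr sub0r oppr_eq0 scaler_eq0 (negPf v0) orbF.
  lra.
split.
(* The ray is now parametrised by multiples of (T / 2) v, so it reaches K at parameter 2. *)
- exists (p + T *: v); split => //; exists 2 => //=.
  by rewrite closed_segment_param; congr (_ + _ *: _); field.
- move=> [hp [_ _ [H [a [c [_ hpE ->]]] Iac]]] /(_ (p + t1 *: v)).
  have /Iac/= t1c := It1.
  rewrite hpE/= => h; move: t1c; rewrite h ?ltxx//.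
  exists (t1 / (T / 2)) => /=; first by rewrite !divr_ge0// ltW.
  by rewrite closed_segment_param divfK// gt_eqF// divr_gt0.
- rewrite -subset0 => x [[s /= /andP[s0 s1] <-]] [+ _].
  by rewrite closed_segment_param; apply: before; nra.
Qed.

(** The ray from p along v reaches K, where the product with a is at most c, starting from a value
    above c. *)
Lemma timelike_cone_dot_lt0 (R : realType) n (I : set 'rV[R]_n) p v a c :
  timelike_cone I p v -> v != 0 -> I `<=` [set x | dot a x < c] ->
  c < dot a p -> dot a v < 0.
Proof.
move=> [->|[_ [t t0 [_ [[x [[s /= s0 <-] [Kx _]] _ _]]]]]].
  by rewrite eqxx.
move=> v0 Ic cp; have /= := closure_le_half_space Ic Kx.
rewrite closed_segment_param dotDr dotZr => h.
have : s * t * dot a v < 0 by lra.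
rewrite pmulr_rlt0// mulr_gt0// lt_neqAle s0 andbT; apply/eqP => s00.
by move: h; rewrite -s00 !mul0r; lra.
Qed.

(** This is where condition (2) of the order acts: a ray that meets K without lying in a supporting
    hyperplane cannot merely graze K. *)
Lemma precedes_entry (R : realType) n (I : set 'rV[R]_n) p q :
  open I -> convex_set I -> precedes I p q ->
  exists2 t1, 0 < t1 & I (p + t1 *: (q - p)).
Proof.
move=> oI cI [[+ _ _] [[b [[t /= t0 bE] Kb]] nray _]].
rewrite exteriorE// => pI; set v := q - p.
have [y [Iy _]] := Kb.1 _ filterT.
have t_gt0 : 0 < t.
  rewrite lt_neqAle t0 andbT; apply/eqP => t00; apply: pI.
  by move: Kb; rewrite -bE -t00 scale0r addr0 => -[].
have [[t1 It1]|nline] := pselect (exists t1, I (p + t1 *: v)).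
  exists t1 => //; rewrite ltNge; apply/negP => t10.
  apply: pI; apply: subset_closure.
  (* If t1 <= 0, then p lies between the point of I at t1 and the point b of K at t; this is the
     weight of the former. *)
  have s0 : 0 < t / (t - t1) by rewrite divr_gt0//; lra.
  have s1 : t / (t - t1) <= 1 by rewrite ler_pdivrMr; lra.
  have := convex_open_closure cI oI It1 Kb.1 s0 s1; rewrite -bE.
  congr I; apply/rowP => i; rewrite !mxE; field.
  by rewrite gt_eqF; lra.
(* If the line misses I, a hyperplane separating b from I + <v> contains the
   line and supports K at b. *)
pose C := [set x | exists s, I (x + s *: v)].
have IC : I `<=` C by move=> x Ix; exists 0; rewrite scale0r addr0.
have oC : open C.
  rewrite openE => x [s Ixs].
  have nI : nbhs (x + s *: v) I by exact: open_nbhs_nbhs.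
  have yx : y + s *: v @[y --> x] --> x + s *: v.
    exact: (cvgD (@cvg_id _ (nbhs x)) (cvg_cst (s *: v))).
  exact: (@filterS _ (nbhs x) (nbhs_filter x) _ C
    (fun z Iz => ex_intro _ s Iz) (yx I nI)).
have cC : convex_set C.
  move=> x1 x2 k; rewrite !inE => -[s1 Is1] [s2 Is2].
  exists (k%:num * s1 + (1 - k%:num) * s2).
  have k0 : 0 <= k%:num by [].
  have k1 : k%:num <= 1 by [].
  have := convex_setP cI Is1 Is2 k0 k1; congr I.
  by apply/rowP => i; rewrite !mxE /unstable.onem; ring.
have nCb : ~ C b.
  move=> [s Is]; apply: nline; exists (t + s).
  by move: Is; rewrite -bE -addrA -scalerDl.
have [|a Ca] := open_convex_separation oC cC _ nCb.
  by exists y; exact: IC.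
(* [C] is invariant under translations along v; were a.v nonzero, it would contain points with every
   value of the product, including a.b. *)
have av : dot a v = 0.
  apply/eqP; apply: contraT => av.
  have : C (y + ((dot a b - dot a y) / dot a v) *: v).
    exists (- ((dot a b - dot a y) / dot a v)).
    by rewrite -addrA -scalerDl subrr scale0r addr0.
  by move=> /Ca; rewrite dotDr dotZr divfK// addrC subrK ltxx.
exfalso; apply: nray; exists [set x | dot a x = dot a b]; last first.
  by move=> _ [s _ <-] /=; rewrite -bE !dotDr !dotZr av !mulr0.
have a0 : a != 0.
  by apply/eqP => a0; have := Ca _ (IC _ Iy); rewrite a0 !dot0l ltxx.
split; first by exists a, (dot a b).
  by exists b.
exists [set x | dot a x < dot a b]; first by exists a, (dot a b).
by move=> x /IC /Ca.
Qed.

(** As p is outside the closure of I, the first hit of K is the entry point into this closure. It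
    lies beyond q, hence T > 1, because the segment from p to q avoids K. *)
Lemma precedes_first_hit (R : realType) n (I : set 'rV[R]_n) p q :
  open I -> convex_set I -> precedes I p q ->
  exists T t1, [/\ 1 < T < t1, hypersurface I (p + T *: (q - p)),
    I (p + t1 *: (q - p)),
    forall s, 0 <= s -> s < T -> ~ closure I (p + s *: (q - p)) &
    first_hit I p q = p + T *: (q - p)].
Proof.
move=> oI cI pq; have [t1 t10 It1] := precedes_entry oI cI pq.
case: pq => -[pI qI _] [_ _ seg]; move: pI qI; rewrite exteriorE// => pI qI.
have [T [T0 Tt1 KT before _]] := entry_point oI cI pI t10 It1.
have T1 : 1 < T.
  rewrite ltNge; apply/negP => T1.
  move: seg; rewrite -subset0 => /(_ (p + T *: (q - p))); apply; split => //.
  by exists T => //=; rewrite T1 ltW.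
exists T, t1; split => //; first by rewrite T1.
apply: xget_unique.
  by exists T; split => //; [lra|move=> s s0 sT [+ _]; exact: before].
move=> b [T' [T'0 bE Kb T'min]]; rewrite bE; congr (_ + _ *: _).
apply/eqP; rewrite eq_le !leNgt; apply/andP; split; apply/negP => TT'.
- by apply: (T'min T) => //; lra.
- by apply: (before T') => //; rewrite -bE; case: Kb.
Qed.

(** * The functional [f_F] *)

Lemma funk_functional_le (R : realType) n (I : set 'rV[R]_n) p v a b :
  hypersurface I b -> I `<=` [set x | dot a x < dot a b] ->
  dot a b < dot a p -> timelike_cone I p v ->
  funk_functional I p v <= - dot a v / (dot a p - dot a b).
Proof.
move=> Kb Iab bp pv; rewrite /funk_functional; case: eqVneq => [->|v0].
  by rewrite dot0r oppr0 mul0r.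
have [y [Iy _]] := Kb.1 _ filterT.
have a0 : a != 0.
  by apply/eqP => a0; move: (Iab _ Iy); rewrite /= a0 !dot0l ltxx.
apply: ge_inf; last first.
  exists [set x | dot a x = dot a b]; last by rewrite funk_termE.
  by apply/separating_hyperplanesP; exists a, (dot a b); split => //; exists b.
(* The infimum is a genuine lower bound only for a set bounded below; on the timelike cone all the
   terms are nonnegative. *)
exists 0 => _ [hp /separating_hyperplanesP[a' [c [a'0 -> _ Ic cp]]] <-].
rewrite funk_termE// divr_ge0 ?subr_ge0 ?(ltW cp)// oppr_ge0 ltW//.
exact: timelike_cone_dot_lt0 Ic cp.
Qed.

(** The term of a separating hyperplane is the inverse of the parameter at which the ray crosses it.
    This parameter is at most T, since p + T v is in K, with equality for the hyperplane given by
    a. *)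
Lemma funk_functional_entry (R : realType) n (I : set 'rV[R]_n) p v t1 T a :
  open I -> convex_set I -> ~ closure I p -> 0 < t1 -> I (p + t1 *: v) ->
  0 < T -> hypersurface I (p + T *: v) ->
  I `<=` [set x | dot a x < dot a (p + T *: v)] -> dot a v < 0 ->
  funk_functional I p v = T^-1.
Proof.
move=> oI cI pI t10 It1 T0 KT Ia av.
have pv := timelike_cone_entry oI cI pI t10 It1.
have v0 : v != 0 by apply/eqP => v0; move: av; rewrite v0 dot0r ltxx.
have ap : dot a (p + T *: v) < dot a p by rewrite dotDr dotZr; nra.
have aT : - dot a v / (dot a p - dot a (p + T *: v)) = T^-1.
  rewrite dotDr dotZr opprD addrA subrr sub0r -mulrN invfM.
  by rewrite mulrCA divff ?mulr1// oppr_eq0 lt_eqF.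
apply/eqP; rewrite eq_le -{1}aT (funk_functional_le KT Ia ap pv)//=.
have [y [Iy _]] := KT.1 _ filterT.
have a0 : a != 0.
  by apply/eqP => a0; move: (Ia _ Iy); rewrite /= a0 !dot0l ltxx.
rewrite /funk_functional (negPf v0); apply: lb_le_inf.
  exists (- dot a v / (dot a p - dot a (p + T *: v))).
  exists [set x | dot a x = dot a (p + T *: v)]; last by rewrite funk_termE.
  apply/separating_hyperplanesP; exists a, (dot a (p + T *: v)); split => //.
  by exists (p + T *: v).
move=> _ [hp /separating_hyperplanesP[a' [c [a'0 -> _ Ic cp]]] <-].
rewrite funk_termE//.
have a'v := timelike_cone_dot_lt0 pv v0 Ic cp.
have /= := closure_le_half_space Ic KT.1.
rewrite dotDr dotZr => h.
rewrite ler_pdivlMr ?subr_gt0// mulrC ler_pdivrMr//; lra.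
Qed.

(* The integral of a nonnegative function is a supremum over the simple
   functions below it, so comparing integrals needs no measurability; this
   avoids proving that f_F is measurable along a timelike curve. *)
Lemma le_integral_nonmeasurable d (T : measurableType d) (R : realType)
    (mu : measure T R) (D : set T) (f g : T -> \bar R) :
  (forall x, D x -> 0 <= g x)%E -> (forall x, D x -> f x <= g x)%E ->
  (\int[mu]_(x in D) f x <= \int[mu]_(x in D) g x)%E.
Proof.
move=> g0 fg; rewrite integralE.
apply: (@le_trans _ _ (\int[mu]_(x in D) (f^\+ x))%E).
  by rewrite -[leRHS]sube0 leeB// integral_ge0.
rewrite !ge0_integralE//; apply: ereal_sup_le => _ [h hf <-]; exists h => // x.
apply: le_trans (hf x) _; rewrite /patch; case: ifP => // xD.
rewrite funeposE ge_max; move: xD; rewrite inE => xD.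
by rewrite fg// g0.
Qed.

(** * Integrals of logarithmic derivatives *)

Lemma log_derivative_continuous (R : realType) (a b : R) (g dg : R -> R) :
  {within `[a, b], continuous g} -> {within `[a, b], continuous dg} ->
  (forall t, a <= t <= b -> 0 < g t) ->
  {within `[a, b], continuous (fun t => - dg t / g t)}.
Proof.
move=> cg cdg g0; apply/subspace_continuousP => t tab; apply: cvgM.
  by apply: cvgN; move/subspace_continuousP : cdg; exact.
apply: cvgV; first by rewrite gt_eqF// g0// -in_itv.
by move/subspace_continuousP : cg; exact.
Qed.

(** Fundamental theorem of calculus for the antiderivative - ln g; at the end points only one-sided
    continuity is at hand. *)
Lemma integral_log_derivative (R : realType) (a b : R) (g dg : R -> R) :
  a < b -> {within `[a, b], continuous g} -> {within `[a, b], continuous dg} ->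
  (forall t, a < t < b -> is_derive t 1 g (dg t)) ->
  (forall t, a <= t <= b -> 0 < g t) ->
  (\int[lebesgue_measure]_(t in `[a, b]) (- dg t / g t)%:E =
    (ln (g a) - ln (g b))%:E)%E.
Proof.
move=> ab cg cdg dgE g0.
have [_ cga cgb] := (continuous_within_itvP _ ab).1 cg.
have abs t : a < t < b -> a <= t <= b by move=> /andP[/ltW-> /ltW->].
have dF t : a < t < b -> is_derive t 1 (fun s => - ln (g s)) (- dg t / g t).
  move=> tab; have gt0 := g0 t (abs t tab).
  have := is_deriveN (is_derive1_comp (is_derive1_ln gt0) (dgE t tab)).
  by rewrite mulrC -mulNr.
have a_in : a <= a <= b by rewrite lexx ltW.
have b_in : a <= b <= b by rewrite lexx ltW.
rewrite (@continuous_FTC2 _ _ (fun s => - ln (g s)))//.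
- by rewrite -EFinB opprK addrC.
- exact: log_derivative_continuous.
- split.
  + by move=> t; rewrite in_itv/= => /dF[].
  + by apply: cvgN; apply: cvg_comp cga _; exact: continuous_ln (g0 a a_in).
  + by apply: cvgN; apply: cvg_comp cgb _; exact: continuous_ln (g0 b b_in).
- by move=> t; rewrite in_itv/= => /dF ?; rewrite derive1E derive_val.
Qed.

(** * One-sided derivatives *)

Lemma right_derivative_dot (R : realType) n (a v : 'rV[R]_n) c sigma t :
  is_right_derivative sigma t v ->
  h^-1 * (dot a (sigma (t + h)) - c - (dot a (sigma t) - c)) @[h --> 0^'+] -->
    dot a v.
Proof.
move=> /cvg_comp/(_ (@dot_continuous R n a v)); apply: cvg_trans.
apply: near_eq_cvg; apply: nearW => h /=.
by rewrite dotZr dotBr; congr (_ * _); ring.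
Qed.

Lemma left_derivative_dot (R : realType) n (a v : 'rV[R]_n) c sigma t :
  is_left_derivative sigma t v ->
  h^-1 * (dot a (sigma (t + h)) - c - (dot a (sigma t) - c)) @[h --> 0^'-] -->
    dot a v.
Proof.
move=> /cvg_comp/(_ (@dot_continuous R n a v)); apply: cvg_trans.
apply: near_eq_cvg; apply: nearW => h /=.
by rewrite dotZr dotBr; congr (_ * _); ring.
Qed.

(** g (t + h) is g t plus h times the quotient, and this product tends to 0 * l. *)
Lemma right_derivative_right_cvg (R : realType) (g : R -> R) (t l : R) :
  h^-1 * (g (t + h) - g t) @[h --> 0^'+] --> l -> g s @[s --> t^'+] --> g t.
Proof.
move=> gl; have : g (t + h) @[h --> 0^'+] --> g t.
  have : g t + h * (h^-1 * (g (t + h) - g t)) @[h --> 0^'+] --> g t + 0 * l.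
    apply: cvgD; first exact: cvg_cst.
    by apply: cvgM gl; apply: cvg_at_right_filter; exact: cvg_id.
  rewrite mul0r addr0; apply: cvg_trans; apply: near_eq_cvg.
  near=> h; have h0 : 0 < h by near: h; exact: nbhs_right_gt.
  by rewrite mulVKf ?gt_eqF// addrC subrK.
by move=> gt A /gt; rewrite /= => hA; apply/nbhs_right0P.
Unshelve. all: by end_near. Qed.

Lemma left_derivative_left_cvg (R : realType) (g : R -> R) (t l : R) :
  h^-1 * (g (t + h) - g t) @[h --> 0^'-] --> l -> g s @[s --> t^'-] --> g t.
Proof.
move=> gl; have : g (t + h) @[h --> 0^'-] --> g t.
  have : g t + h * (h^-1 * (g (t + h) - g t)) @[h --> 0^'-] --> g t + 0 * l.
    apply: cvgD; first exact: cvg_cst.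
    by apply: cvgM gl; apply: cvg_at_left_filter; exact: cvg_id.
  rewrite mul0r addr0; apply: cvg_trans; apply: near_eq_cvg.
  near=> h; have h0 : h < 0 by near: h; exact: nbhs_left_lt.
  by rewrite mulVKf ?lt_eqF// addrC subrK.
move=> gt A /gt /(nbhs_left0P 0 (fun h => A (g (t + h)))) hA.
by apply/nbhs_left0P; apply: filterS hA => h; rewrite sub0r.
Unshelve. all: by end_near. Qed.

Lemma cvg_right_left_dnbhs (R : realType) (T : topologicalType) (f : R -> T)
    (p : R) (l : T) :
  f x @[x --> p^'+] --> l -> f x @[x --> p^'-] --> l -> f x @[x --> p^'] --> l.
Proof.
move=> fr fl A lA; have := fl A lA; have := fr A lA; rewrite !near_simpl.
rewrite /at_right /at_left /dnbhs !near_withinE; apply: filterS2 => x xr xl.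
by rewrite neq_lt => /orP[/xl|/xr].
Qed.

Lemma is_derive_left_right (R : realType) (g : R -> R) (t l : R) :
  h^-1 * (g (t + h) - g t) @[h --> 0^'+] --> l ->
  h^-1 * (g (t + h) - g t) @[h --> 0^'-] --> l -> is_derive t 1 g l.
Proof.
move=> gr gl; have gd : h^-1 * (g (t + h) - g t) @[h --> 0^'] --> l.
  exact: cvg_right_left_dnbhs.
have {}gd : h^-1 *: (g (h *: 1 + t) - g t) @[h --> 0^'] --> l.
  move: gd; apply: cvg_trans; apply: near_eq_cvg; apply: nearW => h /=.
  by rewrite /GRing.scale/= mulr1 [t + h]addrC.
by split; [apply/cvg_ex; exists l|exact: cvg_lim gd].
Qed.

Lemma derive1_left_right (R : realType) n (sigma : R -> 'rV[R]_n) t v :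
  is_right_derivative sigma t v -> is_left_derivative sigma t v ->
  derive1 sigma t = v.
Proof.
move=> sr sl; 
have sd : h^-1 *: (sigma (t + h) - sigma t) @[h --> 0^'] --> v.
  exact: cvg_right_left_dnbhs.
apply: cvg_lim; first exact: (@norm_hausdorff R 'rV[R]_n).
move: sd; apply: cvg_trans; apply: near_eq_cvg; apply: nearW => h /=.
by rewrite [t + h]addrC.
Qed.

(** The sign of [dg] is known only where g is positive, so monotonicity cannot be used at once.
    After the last point T with g T <= 0 the function is positive, hence nonincreasing on [T, b],
    and g b <= g T <= 0 is absurd. *)
Lemma nonincreasing_positive (R : realType) (a b : R) (g dg : R -> R) :
  {within `[a, b], continuous g} ->
  (forall t, a < t < b -> is_derive t 1 g (dg t)) ->
  (forall t, a < t < b -> 0 < g t -> dg t <= 0) -> 0 < g b ->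
  forall t, a <= t <= b -> 0 < g t.
Proof.
move=> cg dgE dg0 gb t /andP[at_ tb].
rewrite ltNge; apply/negP => gt0.
pose E := [set s | t <= s <= b /\ g s <= 0].
have Et : E t by rewrite /E/= lexx tb.
have ubE : ubound E b by move=> s [/andP[]].
have hE : has_sup E by split; [exists t|exists b].
pose T := sup E.
have ET s : E s -> s <= T by move=> Es; apply: ub_le_sup => //; exists b.
have tT : t <= T by exact: ET.
have Tb : T <= b by apply: ge_sup => //; exists t.
have aTb : `[a, b]%classic T by rewrite /= in_itv/= Tb (le_trans at_).
(* The supremum belongs to [E]: by continuity, g T > 0 would make g positive at points of [E] close
   to T. *)
have gT : g T <= 0.
  rewrite leNgt; apply/negP => gT.
  have cgT := (subspace_continuousP _ _).1 cg T aTb.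
  have gTn : nbhs (g T) [set y | 0 < y].
    by apply: open_nbhs_nbhs; split => //; exact: open_gt.
  have /nbhs_ballP[e /= e0 He] := cgT _ gTn.
  have [s Es Ts] := sup_adherent e0 hE.
  have [/andP[ts sb] gs] := Es.
  suff : 0 < g s by rewrite ltNge gs.
  apply: He; last by rewrite in_itv/= sb (le_trans at_).
  by rewrite /ball/= ger0_norm ?subr_ge0 ?ET//; move: Ts; rewrite -/T; lra.
have {}Tb : T < b.
  rewrite lt_neqAle Tb andbT; apply/eqP => Tb'.
  by move: gT; rewrite Tb' leNgt gb.
have gpos s : T < s -> s <= b -> 0 < g s.
  move=> Ts sb; rewrite ltNge; apply/negP => gs.
  have /ET : E s by split => //; rewrite sb (le_trans tT)// ltW.
  by rewrite leNgt Ts.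
have aT : a <= T by exact: le_trans tT.
have sub s : s \in `]T, b[ -> a < s < b.
  by rewrite in_itv/= => /andP[Ts ->]; rewrite (le_lt_trans aT).
suff : g b <= g T by rewrite leNgt (le_lt_trans gT).
apply: (@ler0_derive1_nincr R g T b) => //.
- by move=> s /sub /dgE[].
- move=> s sTb; have /dgE ? := sub _ sTb; rewrite derive1E derive_val.
  apply: dg0; first exact: sub.
  by move: sTb; rewrite in_itv/= => /andP[Ts /ltW]; exact: gpos.
- apply: continuous_subspaceW cg => s /=; rewrite !in_itv/= => /andP[Ts ->].
  by rewrite (le_trans aT).
- exact: ltW.
Qed.

(** * Length of timelike curves *)

(** A measurable majorant with known integral is produced, rather than a bound on the integral of
    f_F, so that pieces can be glued without measurability of f_F along the curve. Positivity is
    assumed at b and passed back to a, which lets pieces be chained from the right. *)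
Lemma C1_segment_majorant (R : realType) n (I : set 'rV[R]_n)
    (sigma : R -> 'rV[R]_n) (a b : R) (e y : 'rV[R]_n) :
  a < b -> C1_on_segment a b sigma ->
  hypersurface I y -> I `<=` [set x | dot e x < dot e y] ->
  (forall t v, a <= t < b -> is_right_derivative sigma t v ->
    timelike_cone I (sigma t) v) ->
  dot e y < dot e (sigma b) ->
  dot e y < dot e (sigma a) /\
  exists u : R -> R, [/\ measurable_fun `[a, b] u,
    forall t, a <= t <= b ->
      0 <= u t /\ funk_functional I (sigma t) (derive1 sigma t) <= u t &
    (\int[lebesgue_measure]_(t in `[a, b]) (u t)%:E =
      (ln (dot e (sigma a) - dot e y) - ln (dot e (sigma b) - dot e y))%:E)%E].
Proof.
move=> ab [ds [cds dsr dsl]] Ky Iy cone yb.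
pose g t := dot e (sigma t) - dot e y; pose dg t := dot e (ds t).
have gr t tab := @right_derivative_dot R n e _ (dot e y) sigma t (dsr t tab).
have gl t tab := @left_derivative_dot R n e _ (dot e y) sigma t (dsl t tab).
have oc t : a < t < b -> a < t <= b by move=> /andP[-> /ltW].
have co t : a < t < b -> a <= t < b by move=> /andP[/ltW ->].
have dgE t : a < t < b -> is_derive t 1 g (dg t).
  move=> tab; apply: is_derive_left_right; first exact: gr (co _ tab).
  exact: gl (oc _ tab).
have cg : {within `[a, b], continuous g}.
  apply/(continuous_within_itvP _ ab); split.
  - move=> t; rewrite in_itv/= => tab; have := dgE t tab => -[gt _].
    exact/differentiable_continuous/derivable1_diffP.
  - by apply: right_derivative_right_cvg (gr a _); rewrite lexx.
  - by apply: left_derivative_left_cvg (gl b _); rewrite lexx ab.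
have cdg : {within `[a, b], continuous dg}.
  apply/subspace_continuousP => t tab.
  have cdst := (subspace_continuousP _ _).1 cds t tab.
  exact: cvg_comp cdst (@dot_continuous R n e (ds t)).
have dg0 t : a < t < b -> 0 < g t -> dg t <= 0.
  move=> tab gt; rewrite /dg.
  have [->|dst0] := eqVneq (ds t) 0; first by rewrite dot0r.
  have := cone t _ (co t tab) (dsr t (co t tab)).
  move=> /timelike_cone_dot_lt0 => /(_ _ _ dst0 Iy) h.
  by apply/ltW/h; rewrite -subr_gt0.
have gb : 0 < g b by rewrite subr_gt0.
have g0 := nonincreasing_positive cg dgE dg0 gb.
split; first by rewrite -subr_gt0; apply: g0; rewrite lexx ltW.
pose f t := funk_functional I (sigma t) (derive1 sigma t).
(* The derivative of sigma is a junk value at a break point, so at the ends u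
   is merely chosen large enough. *)
pose u t := if a < t < b then - dg t / g t else Num.max 0 (f t).
have ab_cc t : a < t < b -> a <= t <= b by move=> /andP[/ltW-> /ltW->].
have mu_oo : measurable_fun `]a, b[ (fun t => - dg t / g t).
  apply: (@measurable_funS _ _ _ _ `[a, b]) => //.
  apply: subspace_continuous_measurable_fun => //.
  exact: log_derivative_continuous.
have uE : {in `]a, b[%classic, (fun t => - dg t / g t) =1 u}.
  by move=> t; rewrite inE/= in_itv/= /u => ->.
have mu : measurable_fun `]a, b[ u by exact: eq_measurable_fun uE mu_oo.
exists u; split.
- exact: measurable_fun_itv_cc mu.
- move=> t tab; rewrite /u; case: ifPn => [tab'|_].
    have gt := g0 t tab.
    have pt := cone t _ (co t tab') (dsr t (co t tab')).
    rewrite divr_ge0 ?oppr_ge0 ?(ltW gt) ?dg0//; split => //.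
    rewrite (derive1_left_right (dsr t (co t tab')) (dsl t (oc t tab'))).
    by apply: funk_functional_le => //; rewrite -subr_gt0.
  by split; rewrite le_max lexx ?orbT.
- rewrite -(integral_log_derivative ab cg cdg dgE g0).
  apply: eq_integral_itv_bounded => //.
  by move=> t; rewrite in_itv/= /u => ->.
Qed.

(** Induction on the break points: the tail [x, b] comes first and yields positivity at x, which the
    first piece [a, x] needs. The logarithms telescope. *)
Lemma piecewise_C1_majorant (R : realType) n (I : set 'rV[R]_n)
    (sigma : R -> 'rV[R]_n) (a b : R) (s : seq R) (e y : 'rV[R]_n) :
  itv_partition a b s ->
  (forall i, (i < size s)%N ->
    C1_on_segment (nth 0 (a :: s) i) (nth 0 s i) sigma) ->
  hypersurface I y -> I `<=` [set x | dot e x < dot e y] ->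
  (forall t v, a <= t < b -> is_right_derivative sigma t v ->
    timelike_cone I (sigma t) v) ->
  dot e y < dot e (sigma b) ->
  dot e y < dot e (sigma a) /\
  exists u : R -> R, [/\ measurable_fun `[a, b] u,
    forall t, a <= t <= b ->
      0 <= u t /\ funk_functional I (sigma t) (derive1 sigma t) <= u t &
    (\int[lebesgue_measure]_(t in `[a, b]) (u t)%:E =
      (ln (dot e (sigma a) - dot e y) - ln (dot e (sigma b) - dot e y))%:E)%E].
Proof.
move=> + + Ky Iy; elim: s a => [|x s IHs] a abs C1s cone yb.
  have -> := itv_partition_nil abs; split => //.
  exists (cst (Num.max 0 (funk_functional I (sigma b) (derive1 sigma b)))).
  split; first exact: measurable_cst.
    move=> t; rewrite -eq_le => /eqP <-.
    by split; rewrite le_max lexx ?orbT.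
  by rewrite set_itv1 integral_set1 subrr.
have ax : a < x by case: abs => /= /andP[].
have xbs := itv_partition_cons abs.
have xb : x <= b by exact: itv_partition_le xbs.
have [||yx [u2 [mu2 u2f iu2]]] := IHs x xbs _ _ yb.
  by move=> i si; exact: (C1s i.+1).
  by move=> t v /andP[xt tb]; apply: cone; rewrite tb (le_trans (ltW ax)).
have [|ya [u1 [mu1 u1f iu1]]] :=
    C1_segment_majorant ax (C1s 0%N isT) Ky Iy _ yx.
  by move=> t v /andP[at_ tx]; apply: cone; rewrite at_ (lt_le_trans tx).
(* The break point x is given to the second piece, so that the two domains are disjoint. *)
split => //; pose u t := if t < x then u1 t else u2 t.
have abE : `[a, b]%classic = `[a, x[ `|` `[x, b].
  by rewrite -itv_bndbnd_setU// bnd_simp ?ltW.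
have u1E : {in `[a, x[%classic, u1 =1 u}.
  by move=> t; rewrite inE/= in_itv/= /u => /andP[_ ->].
have u2E : {in `[x, b]%classic, u2 =1 u}.
  by move=> t; rewrite inE/= in_itv/= /u leNgt => /andP[/negPf ->].
have m1 : measurable_fun `[a, x[ u1.
  by apply: measurable_funS mu1 => //; exact: subset_itv_co_cc.
have mu1' : measurable_fun `[a, x[ u by exact: eq_measurable_fun u1E m1.
have mu2' : measurable_fun `[x, b] u by exact: eq_measurable_fun u2E mu2.
have mu : measurable_fun `[a, b] u by rewrite abE; apply/measurable_funU.
have u0 t : a <= t <= b -> 0 <= u t /\
    funk_functional I (sigma t) (derive1 sigma t) <= u t.
  move=> /andP[at_ tb]; rewrite /u; have [tx|xt] := ltP t x.
    by apply: u1f; rewrite at_ ltW.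
  by apply: u2f; rewrite xt.
exists u; split => //; rewrite abE ge0_integral_setU//=.
- have -> : (\int[lebesgue_measure]_(t in `[a, x[) (u t)%:E =
      \int[lebesgue_measure]_(t in `[a, x]) (u1 t)%:E)%E.
    rewrite -integral_itv_bndo_bndc; last exact/measurable_EFinP.
    by apply: eq_integral => t /u1E ->.
  have -> : (\int[lebesgue_measure]_(t in `[x, b]) (u t)%:E =
      \int[lebesgue_measure]_(t in `[x, b]) (u2 t)%:E)%E.
    by apply: eq_integral => t /u2E ->.
  by rewrite iu1 iu2 -EFinD; congr EFin; ring.
- by rewrite -abE; exact/measurable_EFinP.
- move=> t; rewrite -[_ \/ _]/((`[a, x[ `|` `[x, b]) t) -abE /= in_itv/=.
  by move=> /u0[]; rewrite lee_fin.
- apply/disj_setPS => t [] /=; rewrite !in_itv/= => /andP[_ tx] /andP[].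
  by rewrite leNgt tx.
Qed.

(** * Straight segments *)

Lemma curve_length_le (R : realType) n (I : set 'rV[R]_n) p q sigma e y :
  hypersurface I y -> I `<=` [set x | dot e x < dot e y] ->
  dot e y < dot e q -> timelike_curve I p q sigma ->
  (curve_length I sigma <=
    (ln (dot e p - dot e y) - ln (dot e q - dot e y))%:E)%E.
Proof.
move=> Ky Iy yq [[s [s01 C1s]] _ cone _ [sp sq]]; rewrite -sp -sq in yq *.
have [_ [u [_ uf <-]]] := piecewise_C1_majorant s01 C1s Ky Iy cone yq.
apply: le_integral_nonmeasurable => t /=; rewrite in_itv/= => /uf[];
by rewrite !lee_fin.
Qed.

Lemma line_quotient (R : realType) n (p v : 'rV[R]_n) t (h : R) :
  h != 0 -> h^-1 *: (p + (t + h) *: v - (p + t *: v)) = v.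
Proof.
move=> h0; rewrite scalerDl addrA [_ + h *: v]addrC addrK.
by rewrite scalerA mulVf ?scale1r.
Qed.

Lemma line_right_derivative (R : realType) n (p v : 'rV[R]_n) t :
  is_right_derivative (fun s => p + s *: v) t v.
Proof.
apply: cvg_trans (@cvg_cst _ v _ (0 : R)^'+ _); apply: near_eq_cvg; near=> h.
have h0 : 0 < h by near: h; exact: nbhs_right_gt.
by rewrite line_quotient// gt_eqF.
Unshelve. all: by end_near. Qed.

Lemma line_left_derivative (R : realType) n (p v : 'rV[R]_n) t :
  is_left_derivative (fun s => p + s *: v) t v.
Proof.
apply: cvg_trans (@cvg_cst _ v _ (0 : R)^'- _); apply: near_eq_cvg; near=> h.
have h0 : h < 0 by near: h; exact: nbhs_left_lt.
by rewrite line_quotient// lt_eqF.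
Unshelve. all: by end_near. Qed.

Lemma line_timelike_curve (R : realType) n (I : set 'rV[R]_n) p v :
  (forall t, 0 <= t <= 1 -> exterior I (p + t *: v)) ->
  (forall t, 0 <= t <= 1 -> timelike_cone I (p + t *: v) v) ->
  timelike_curve I p (p + v) (fun t => p + t *: v).
Proof.
move=> ext cone; split => //.
- exists [:: 1]; split; first by apply: itv_partition1.
  case=> // _; exists (cst v); split.
  + by apply: continuous_subspaceT => t; exact: cvg_cst.
  + by move=> t _; exact: line_right_derivative.
  + by move=> t _; exact: line_left_derivative.
- move=> t w /andP[t0 t1] pw.
  have -> : w = v.
    apply: (@cvg_unique _ (@norm_hausdorff R 'rV[R]_n) _ _ _ _ pw).
    exact: line_right_derivative.
  by apply: cone; rewrite t0 ltW.
- move=> t w /andP[t0 t1] pw.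
  have -> : w = v.
    apply: (@cvg_unique _ (@norm_hausdorff R 'rV[R]_n) _ _ _ _ pw).
    exact: line_left_derivative.
  by apply: cone; rewrite t1 ltW.
- by rewrite scale0r addr0 scale1r.
Qed.

Lemma derive1_line (R : realType) n (p v : 'rV[R]_n) t :
  derive1 (fun s => p + s *: v) t = v.
Proof.
apply: (@derive1_left_right R n (fun s => p + s *: v)).
  exact: line_right_derivative.
exact: line_left_derivative.
Qed.

Lemma integral_inv_affine (R : realType) (T : R) : 1 < T ->
  (\int[lebesgue_measure]_(t in `[0%R, 1%R]) ((T - t)^-1)%:E =
    (ln (T / (T - 1)))%:E)%E.
Proof.
move=> T1.
have dg (t : R) : is_derive t 1 (fun s : R => T - s) (- 1).
  rewrite -[- 1]add0r; exact: is_deriveB.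
have cg : continuous (fun s : R => T - s).
  by move=> t; apply: cvgB; [exact: cvg_cst|exact: cvg_id].
have g0 (t : R) : 0 <= t <= 1 -> 0 < T - t.
  by move=> /andP[_ t1]; rewrite subr_gt0 (le_lt_trans t1).
rewrite ln_div ?posrE ?subr_gt0//; last exact: lt_trans T1.
rewrite -[X in ln X - _](subr0 T).
rewrite -(@integral_log_derivative R 0 1 (fun t => T - t) (cst (- 1)))//.
- by apply: eq_integral => t _; rewrite opprK div1r.
- exact: continuous_subspaceT.
- by apply: continuous_subspaceT => t; exact: cvg_cst.
Qed.

(** * Equality of the timelike Funk distance and the intrinsic distance *)

Theorem theorem5p4 (R : realType) (n : nat) (I : set 'rV[R]_n)
    (I_nonempty : I !=set0) (I_open : open I) (I_convex : convex_set I)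
    (I_proper : I <> setT) (p q : 'rV[R]_n)
    (p_ext : exterior I p) (q_ext : exterior I q) (p_le_q : precedes_eq I p q) :
  (funk_dist I p q)%:E = intrinsic_dist I p q.
Proof.
have pI := p_ext; rewrite exteriorE// in pI.
apply/eqP; rewrite eq_le; case: p_le_q => [pq|pq].
- have [T [t1 [/andP[T1 Tt1] KT It1 before hit]]] :=
    precedes_first_hit I_open I_convex pq.
  set v := q - p in KT It1 before hit.
  have qE : q = p + v by rewrite addrC subrK.
  have pneq : p != q by case: pq => -[].
  have v0 : v != 0 by rewrite subr_eq0 eq_sym.
  clearbody v.
  have [a Ia av] :
      exists2 a, I `<=` [set x | dot a x < dot a (p + T *: v)] & dot a v < 0.
    have [|a Ia] :=
      open_convex_separation I_open I_convex I_nonempty (b := p + T *: v).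
      by move=> IT; case: KT => _; rewrite (interior_id I).1.
    exists a => //; have := Ia _ It1; rewrite !dotDr !dotZr; nra.
  (* The distances from p and q to the hit point are T and T - 1 times the norm of v. *)
  have Fpq : funk_dist I p q = ln (T / (T - 1)).
    rewrite /funk_dist (negPf pneq) hit /eucl_dist; congr ln.
    have -> : p - (p + T *: v) = T *: - v.
      by rewrite opprD addrA subrr sub0r scalerN.
    have -> : q - (p + T *: v) = (1 - T) *: v.
      by rewrite qE opprD addrACA subrr add0r scalerBl scale1r.
    rewrite !eucl_normZ /eucl_norm dotNl dotNr opprK.
    rewrite (gtr0_norm (x := T)); last lra.
    rewrite ltr0_norm; last lra.
    by rewrite opprB -mulf_div divff ?mulr1// gt_eqF// sqrtr_gt0 dot_gt0.
  have shift t s : p + t *: v + (s - t) *: v = p + s *: v.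
    by rewrite -addrA -scalerDl [t + _]addrC subrK.
  apply/andP; split.
  + apply: ereal_sup_ubound; exists (fun t => p + t *: v).
      rewrite qE; apply: line_timelike_curve => t /andP[t0 t1'].
        by rewrite exteriorE//; apply: before => //; lra.
      (* Seen from p + t v, the point of I on the ray is at parameter t1 - t. *)
      apply: (@timelike_cone_entry _ _ _ _ _ (t1 - t)) => //; last first.
        by rewrite shift.
        lra.
      by apply: before => //; lra.
    rewrite Fpq -integral_inv_affine//; apply: eq_integral => t.
    rewrite inE/= in_itv/= => /andP[t0 t1']; rewrite derive1_line; congr EFin.
    rewrite -(shift t) in It1; rewrite -(shift t) in KT Ia.
    have pt : ~ closure I (p + t *: v) by apply: before => //; lra.
    by apply: funk_functional_entry I_open I_convex pt _ It1 _ KT Ia av; lra.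
  + apply: ge_ereal_sup => _ [sigma sigmaP <-]; rewrite Fpq.
    have yq : dot a (p + T *: v) < dot a q by rewrite qE !dotDr dotZr; nra.
    apply: (le_trans (curve_length_le KT Ia yq sigmaP)); rewrite lee_fin.
    (* Both heights above the hyperplane are multiples of - a.v, so their ratio is again T / (T -
       1). *)
    have -> : dot a p - dot a (p + T *: v) = T * - dot a v.
      by rewrite dotDr dotZr; ring.
    have -> : dot a q - dot a (p + T *: v) = (T - 1) * - dot a v.
      by rewrite qE !dotDr dotZr; ring.
    rewrite -ln_div ?posrE; [|nra|nra].
    by rewrite -mulf_div divff ?mulr1// oppr_eq0 lt_eqF.
- rewrite -pq /funk_dist eqxx; apply/andP; split.
  (* The constant curve, seen as a line of direction 0, has length 0. *)
  + apply: ereal_sup_ubound; exists (fun t => p + t *: 0).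
      rewrite -{2}[p]addr0; apply: line_timelike_curve => t _.
        by rewrite scaler0 addr0.
      by left.
    rewrite /curve_length integral0_eq// => t _.
    by rewrite derive1_line /funk_functional eqxx.
  (* The ray from p to any point of I yields a hyperplane separating p from I; the bound it gives
     for closed timelike curves at p is ln - ln = 0. *)
  + have [x Ix] := I_nonempty.
    have [|T [T0 _ KT _ [a Ia av]]] :=
      @entry_point _ _ I p (x - p) 1 I_open I_convex pI ltr01.
      by rewrite scale1r addrC subrK.
    have yp : dot a (p + T *: (x - p)) < dot a p.
      by rewrite dotDr dotZr gtrDl pmulr_rlt0.
    apply: ge_ereal_sup => _ [sigma sigmaP <-].
    by rewrite (le_trans (curve_length_le KT Ia yp sigmaP))// subrr.
Qed.
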